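(* Let $p\ge2$ be an integer and let $H$ be a $p$-star. Let $U\subset[0,1]\times\mathbb{R}$ be the $U$-shaped region associated with this $p$, as defined in the context. Then for every $\epsilon\in[0,1]$ and every $\beta_2\in\mathbb{R}$ such that $(\epsilon,2\beta_2)\notin U$, the optimizing graphon of the variational problem $$\psi(\epsilon,\beta_2)=\sup\left\{\beta_2 t(H,h)-\frac12\iint_{[0,1]^2}I(h(x,y))\,dx\,dy\;:\;h\text{ a graphon},\ \iint_{[0,1]^2}h(x,y)\,dx\,dy=\epsilon\right\}$$ is uniform.
   Context: A graphon is a measurable function $h:[0,1]^2\to[0,1]$ with $h(x,y)=h(y,x)$. $I(x)=x\log x+(1-x)\log(1-x)$ on $[0,1]$, with $0\log 0=0$. The $p$-star is the graph with $p+1$ vertices and $p$ edges, all of which share one common vertex; for it the homomorphism density is $t(H,h)=\int_0^1\left(\int_0^1 h(x,y)\,dy\right)^p dx$. An optimizing graphon is a graphon with $\iint h=\epsilon$ attaining the supremum in the definition of $\psi(\epsilon,\beta_2)$. ''The optimizing graphon is uniform'' means that every optimizing graphon is a.e. constant (hence a.e. equal to $\epsilon$). The $U$-shaped region for an integer $p\ge2$: put $b_c=\frac{p^{p-1}}{(p-1)^p}$. For each real $b>b_c$ there is a unique $a\in\mathbb{R}$ such that the function $\ell(x)=ax+bx^p-x\log x-(1-x)\log(1-x)$ on $[0,1]$ has two distinct global maximizers; denote them $0<x_1(b)<x_2(b)<1$. Then $U=\{(\epsilon,b): b>b_c,\ x_1(b)<\epsilon<x_2(b)\}$. *)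

(* Defs.v *)
From HB Require Import structures.
From mathcomp Require Import all_boot all_order all_algebra.
From mathcomp Require Import all_classical all_reals all_analysis.

Set Implicit Arguments.
Unset Strict Implicit.
Unset Printing Implicit Defensive.

Import Order.TTheory GRing.Theory Num.Theory.
Import numFieldNormedType.Exports.

Local Open Scope classical_set_scope.
Local Open Scope ring_scope.

Definition unit_itv (R : realType) : set R := `[0, 1]%classic.
Arguments unit_itv : clear implicits.

Definition unit_square (R : realType) : set (R * R) :=
  unit_itv R `*` unit_itv R.
Arguments unit_square : clear implicits.

Notation leb R := (@lebesgue_measure R).

Notation leb2 R := (@lebesgue_measure R \x @lebesgue_measure R)%E.

(* A function on [0,1]^2 is represented by a function on R * R of which only
   the values on the unit square matter; measurability is with respect to the
   Borel sigma-algebra. *)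
Definition graphon (R : realType) (h : R * R -> R) : Prop :=
  [/\ measurable_fun (unit_square R) h,
      forall z, unit_square R z -> 0 <= h z <= 1 &
      forall x y, unit_square R (x, y) -> h (x, y) = h (y, x)].

(* The convention 0 log 0 = 0 holds because of the factor 0. *)
Definition entropyI (R : realType) (x : R) : R :=
  x * ln x + (1 - x) * ln (1 - x).

Definition edge_density (R : realType) (h : R * R -> R) : R :=
  \int[leb2 R]_(z in unit_square R) h z.

Definition star_density (R : realType) (p : nat) (h : R * R -> R) : R :=
  \int[leb R]_(x in unit_itv R) (\int[leb R]_(y in unit_itv R) h (x, y)) ^+ p.

Definition objective (R : realType) (p : nat) (beta2 : R) (h : R * R -> R) : R :=
  beta2 * star_density p h
  - 2^-1 * \int[leb2 R]_(z in unit_square R) entropyI (h z).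

Definition feasible (R : realType) (eps : R) : set (R * R -> R) :=
  [set h | graphon h /\ edge_density h = eps].

Definition psi (R : realType) (p : nat) (eps beta2 : R) : R :=
  sup (objective p beta2 @` feasible eps).

Definition optimizing_graphon (R : realType) (p : nat) (eps beta2 : R)
    (h : R * R -> R) : Prop :=
  feasible eps h /\ objective p beta2 h = psi p eps beta2.

Definition uniform_graphon (R : realType) (h : R * R -> R) : Prop :=
  exists c : R, {ae leb2 R, forall z, unit_square R z -> h z = c}.

Definition ell (R : realType) (p : nat) (a b x : R) : R :=
  a * x + b * x ^+ p - x * ln x - (1 - x) * ln (1 - x).

Definition ell_maximizers (R : realType) (p : nat) (a b : R) : set R :=
  [set x | unit_itv R x /\ forall y, unit_itv R y -> ell p a b y <= ell p a b x].

Definition b_crit (R : realType) (p : nat) : R :=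
  p%:R ^+ p.-1 / p.-1%:R ^+ p.

(* For p >= 2 and b > b_crit the triple (a, x1, x2) below is unique, so the
   existential quantifier expresses x1(b) < eps < x2(b). *)
Definition U_region (R : realType) (p : nat) : set (R * R) :=
  [set eb | b_crit R p < eb.2 /\
    exists a x1 x2 : R,
      [/\ 0 < x1, x1 < x2, x2 < 1,
          ell_maximizers p a eb.2 = [set x1; x2] & x1 < eb.1 < x2]].
Arguments U_region : clear implicits.

(* Main.v *)
Require Import Defs.
From mathcomp Require Import all_boot all_order all_algebra.
From mathcomp Require Import all_classical all_reals all_analysis.
From mathcomp Require Import measurable_realfun ring lra.

Import Order.TTheory GRing.Theory Num.Theory.
Import numFieldNormedType.Exports.
Local Open Scope classical_set_scope.
Local Open Scope ring_scope.

(** Write [b = 2 beta2], [E] for the integral over the square and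
    [d x = \int h (x, y) dy], so that twice the objective is
    [b \int d^p - E (I h)].
    If [b <= 0], the tangent lines at [eps] of the convex functions [x^p] and
    [I] bound this by its value at the constant graphon, with equality only if
    [h = eps] a.e., since [I] is strictly convex.
    If [b > 0], outside [U] the graph of [b x^p - I x] lies below its tangent
    line at [eps]; combined with the tangent inequality
    [h^p >= d^p + p d^(p-1) (h - d)], whose last term integrates to zero, this
    gives the same bound, with equality only if [h (x, y) = d x] a.e.  Since
    [h] is symmetric it is then constant.
    The tangent line exists because, as the slope [a] varies, the maxima of
    [ell] over [[0, eps]] and over [[eps, 1]] agree for some [a]: then [ell] has
    global maximizers [x1 <= eps <= x2], and if both inequalities are strict
    counting zeros of derivatives shows that [eps] is in [U]. *)

(** * Tangent inequalities for powers and entropy; continuity and derivative of [ell] *)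

Section EntropyCalculus.
Context {R : realType}.
Implicit Types a b c d e s t x y z : R.

(** The exponent starts at 2 because for exponent 1 the remainder vanishes identically and the
    equality case fails. *)
Lemma expr_tangent n x c : 0 <= x -> 0 <= c ->
  0 <= x ^+ n.+2 - c ^+ n.+2 - n.+2%:R * c ^+ n.+1 * (x - c) ?= iff (x == c).
Proof.
move=> x0 c0; elim: n => [|n [IHle IHeq]].
  have -> : x ^+ 2 - c ^+ 2 - 2%:R * c ^+ 1 * (x - c) = (x - c) ^+ 2 by ring.
  by split; [exact: sqr_ge0 | rewrite eq_sym sqrf_eq0 subr_eq0].
(* The remainders satisfy [T (n+1) = x T n + (n+2) c^(n+1) (x - c)^2]. *)
have -> : x ^+ n.+3 - c ^+ n.+3 - n.+3%:R * c ^+ n.+2 * (x - c) =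
    x * (x ^+ n.+2 - c ^+ n.+2 - n.+2%:R * c ^+ n.+1 * (x - c))
    + n.+2%:R * c ^+ n.+1 * (x - c) ^+ 2.
  by rewrite -[n.+3%:R]natr1 !(exprS _ n.+2) !(exprS _ n.+1); ring.
set T := x ^+ n.+2 - _ - _ in IHle IHeq *.
have xT : 0 <= x * T by exact: mulr_ge0.
have cc : 0 <= n.+2%:R * c ^+ n.+1 * (x - c) ^+ 2.
  by rewrite mulr_ge0 ?sqr_ge0// mulr_ge0// exprn_ge0.
split; first exact: addr_ge0.
rewrite eq_sym paddr_eq0// !mulf_eq0 pnatr_eq0 /= !expf_eq0 /=.
rewrite -/T [T == 0]eq_sym IHeq subr_eq0.
by have [->|xc] := eqVneq x c; rewrite ?orbT// !orbF; apply: contra_neqF xc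
  => /andP[/eqP-> /eqP->].
Qed.

Lemma ln_lt_sub1 x : 0 < x -> x != 1 -> ln x < x - 1.
Proof.
move=> x0 x1; have := @expR_gt1Dx R (ln x).
by rewrite ln_eq0// x1 lnK// => /(_ isT); lra.
Qed.

(** For [x > 0] this is [ln r < r - 1] at [r = c / x], multiplied by [x]. *)
Lemma xlnx_tangent x c : 0 <= x -> 0 < c -> x != c ->
  x - c < x * (ln x - ln c).
Proof.
move=> + c0; rewrite le_eqVlt => /predU1P[<- _|x0 xc].
  by rewrite mul0r; lra.
have cx : c / x != 1.
  by apply: contra_neq xc => /(congr1 ( *%R^~ x)); rewrite divfK ?gt_eqF// mul1r.
have := ln_lt_sub1 _ (divr_gt0 c0 x0) cx.
rewrite ln_div// -(ltr_pM2l x0) => h.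
have -> : x - c = - (x * (c / x - 1)) by field; rewrite gt_eqF.
by rewrite ltrNl; apply: le_lt_trans h; lra.
Qed.

(** The remainder is the relative entropy [x (ln x - ln c) + (1 - x) (ln (1 - x) - ln (1 - c))].
    Adding [xlnx_tangent] at [(x, c)] and at [(1 - x, 1 - c)] bounds it below by zero, since the
    linear terms cancel. *)
Lemma entropyI_tangent x c : 0 <= x <= 1 -> 0 < c < 1 ->
  0 <= entropyI x - entropyI c - (ln c - ln (1 - c)) * (x - c) ?= iff (x == c).
Proof.
move=> /andP[x0 x1] /andP[c0 c1].
apply/leifP; have [->|xc] := eqVneq x c; first by apply/eqP; ring.
have := @xlnx_tangent _ _ x0 c0 xc.
have := @xlnx_tangent (1 - x) (1 - c).
rewrite !subr_ge0 !subr_gt0 => /(_ x1 c1).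
have -> : 1 - x != 1 - c by apply: contra_neq xc; lra.
by rewrite /entropyI => /(_ isT); lra.
Qed.

(* Follows from [ln r <= r] and [ln r^-1 <= r^-1] at [r = sqrt x]. *)
Lemma xlnx_bound x : `|x * ln x| <= 2 * Num.sqrt x * (`|x| + 1).
Proof.
have [x0|x0] := leP x 0.
  by rewrite ln0// mulr0 normr0 mulr_ge0 ?mulr_ge0 ?sqrtr_ge0// addr_ge0.
have r0 : 0 < Num.sqrt x by rewrite sqrtr_gt0.
rewrite (gtr0_norm x0).
move: (sqr_sqrtr (ltW x0)) r0; set r := Num.sqrt x; clearbody r => <- r0.
rewrite lnXn// mulr2n.
have h1 := ln_sublinear r0.
have : ln r^-1 < r^-1 by apply: ln_sublinear; rewrite invr_gt0.
rewrite lnV// => h2.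
have -> : 2 * r * (r ^+ 2 + 1) = r ^+ 2 * (2 * (r + r^-1)).
  by field; rewrite gt_eqF.
rewrite normrM ger0_norm ?sqr_ge0// ler_wpM2l ?sqr_ge0// ler_norml.
have : 0 < r^-1 by rewrite invr_gt0.
by move=> h3; apply/andP; split; lra.
Qed.

(* True on all of [R] because [ln] is [0] on nonpositive reals. *)
Lemma continuous_xlnx : continuous (fun x => x * ln x : R).
Proof.
move=> x; have [x0|x0] := leP x 0; last first.
  by apply: cvgM; [exact: cvg_id|exact: continuous_ln].
rewrite /continuous_at ln0// mulr0.
apply/norm_cvg0P.
apply: (@squeeze_cvgr _ _ _ _ (cst 0) (fun y => 2 * Num.sqrt y * (`|y| + 1))).
- by near=> y; rewrite normr_ge0 xlnx_bound.
- exact: cvg_cst.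
- rewrite [X in _ --> X](_ : 0 = 2 * Num.sqrt x * (`|x| + 1)); last first.
    by rewrite ler0_sqrtr// mulr0 mul0r.
  apply: cvgM; last by apply: cvgD; [apply: cvg_norm; exact: cvg_id|exact: cvg_cst].
  by apply: cvgM; [exact: cvg_cst|exact: sqrt_continuous].
Unshelve. all: by end_near. Qed.

Lemma continuous_ell p a b : continuous (ell p a b : R -> R).
Proof.
have -> : ell p a b = (fun x => a * x + b * x ^+ p - x * ln x
   - (fun y => y * ln y) (1 - x)) :> (R -> R) by [].
move=> x; apply: cvgB; last first.
  apply: (@cvg_comp _ _ _ (fun y => 1 - y) (fun y => y * ln y)); last first.
    exact: continuous_xlnx.
  by apply: cvgB; [exact: cvg_cst|exact: cvg_id].
apply: cvgB; last exact: continuous_xlnx.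
apply: cvgD; apply: cvgM; try exact: cvg_cst; first exact: cvg_id.
exact: exprn_continuous.
Qed.

Definition dell p a b x := a + b * (p%:R * x ^+ p.-1) - ln x + ln (1 - x).

Lemma is_derive_ln1B x : x < 1 ->
  is_derive x 1 (fun y => ln (1 - y)) (- (1 - x)^-1).
Proof.
move=> x1.
have h : is_derive (1 - x) 1 (@ln R) (1 - x)^-1.
  by apply: is_derive1_ln; rewrite subr_gt0.
have h2 : is_derive x 1 (fun y => 1 - y) (-1).
  apply: is_derive_eq; ring.
have := @is_derive1_comp _ (@ln R) (fun y => 1 - y) x _ _ h h2.
by rewrite mulrN1.
Qed.

Lemma is_derive_exprn n x :
  is_derive x 1 (fun y => y ^+ n) (n%:R * x ^+ n.-1).
Proof.
have -> : (fun y => y ^+ n) = (@id R) ^+ n.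
  by apply/funext => y; rewrite fctE.
by apply: is_derive_eq; rewrite /GRing.scale /= mulr1.
Qed.

Lemma is_derive_ell p a b x : 0 < x < 1 ->
  is_derive x 1 (ell p a b) (dell p a b x).
Proof.
move=> /andP[x0 x1].
have h1 := is_derive1_ln x0; have h2 := is_derive_ln1B _ x1.
have -> : ell p a b = (fun y => a * y) + (fun y => b * y ^+ p)
    - (fun y => y * ln y) - (fun y => (1 - y) * ln (1 - y)) :> (R -> R) by [].
have h3 : is_derive x 1 (fun y => a * y) a.
  by apply: is_derive_eq; rewrite /GRing.scale /=; ring.
have h4 : is_derive x 1 (fun y => b * y ^+ p) (b * (p%:R * x ^+ p.-1)).
  have h := is_derive_exprn p x.
  by apply: is_derive_eq; rewrite /GRing.scale /=; ring.
have h5 : is_derive x 1 (fun y => y * ln y) (ln x + 1).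
  apply: is_derive_eq; rewrite /GRing.scale /=; field; rewrite gt_eqF//.
have h6 : is_derive x 1 (fun y => (1 - y) * ln (1 - y)) (- ln (1 - x) - 1).
  apply: is_derive_eq; rewrite /GRing.scale /=; field; rewrite gt_eqF// subr_gt0//.
by apply: is_derive_eq; rewrite /dell; ring.
Qed.
End EntropyCalculus.

(** * Number and position of the global maximizers of [ell] *)

Section EllMaximizers.
Context {R : realType}.
Implicit Types a b c d e s t x y z : R.

Lemma mvt_open01 (f df : R -> R) x y :
  (forall z, 0 < z < 1 -> is_derive z 1 f (df z)) -> 0 < x -> x < y -> y < 1 ->
  exists2 c, x < c < y & f y - f x = df c * (y - x).
Proof.
move=> fdf x0 xy y1.
have dz z : z \in `[x, y] -> is_derive z 1 f (df z).
  rewrite in_itv/= => /andP[xz zy]; apply: fdf.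
  by rewrite (lt_le_trans x0)//= (le_lt_trans zy).
have dO z : z \in `]x, y[ -> is_derive z 1 f (df z).
  by move=> zxy; apply: dz; exact: subset_itv_oo_cc.
have cf : {within `[x, y], continuous f}.
  by apply: derivable_within_continuous => t /dz[].
by have [c] := MVT xy dO cf; rewrite in_itv; exists c.
Qed.

Lemma rolle_open01 (f df : R -> R) x y :
  (forall z, 0 < z < 1 -> is_derive z 1 f (df z)) -> 0 < x -> x < y -> y < 1 ->
  f x = f y -> exists2 c, x < c < y & df c = 0.
Proof.
move=> fdf x0 xy y1 fxy; have [c cxy] := mvt_open01 _ _ _ _ fdf x0 xy y1.
rewrite fxy subrr => /esym/eqP; rewrite mulf_eq0 subr_eq0 (gt_eqF xy) orbF.
by move=> /eqP; exists c.
Qed.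

Definition d2ell n b x :=
  b * (n.+2%:R * (n.+1%:R * x ^+ n)) - x^-1 - (1 - x)^-1.

Lemma is_derive_dell n a b x : 0 < x < 1 ->
  is_derive x 1 (dell n.+2 a b) (d2ell n b x).
Proof.
move=> /andP[x0 x1].
have h1 := is_derive1_ln x0; have h2 := is_derive_ln1B _ x1.
have h := is_derive_exprn n.+1 x.
have -> : dell n.+2 a b = cst a + (fun y => b * (n.+2%:R * y ^+ n.+1)) - (@ln R)
    + (fun y => ln (1 - y)) :> (R -> R) by [].
have h4 : is_derive x 1 (fun y => b * (n.+2%:R * y ^+ n.+1))
    (b * (n.+2%:R * (n.+1%:R * x ^+ n))).
  by apply: is_derive_eq; rewrite /GRing.scale /=; ring.
by apply: is_derive_eq; rewrite /d2ell; ring.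
Qed.

Lemma is_derive_expr1B n x :
  is_derive x 1 (fun y => y ^+ n.+1 * (1 - y)) (x ^+ n * (n.+1%:R - n.+2%:R * x)).
Proof.
have h := is_derive_exprn n.+1 x.
by apply: is_derive_eq; rewrite /GRing.scale /= exprS; ring.
Qed.

(** Multiply by [x (1 - x)], using [x^-1 + (1 - x)^-1 = (x (1 - x))^-1]. *)
Lemma d2ell_eq0 n b x : 0 < x < 1 -> d2ell n b x = 0 ->
  b * (n.+2%:R * n.+1%:R) * (x ^+ n.+1 * (1 - x)) = 1.
Proof.
move=> /andP[x0 x1] d0.
have -> : b * (n.+2%:R * n.+1%:R) * (x ^+ n.+1 * (1 - x)) =
   d2ell n b x * (x * (1 - x)) + 1.
  by rewrite /d2ell exprS; field; rewrite ?gt_eqF// subr_gt0.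
by rewrite d0 mul0r add0r.
Qed.

(* Zeros of [d2ell] lie on a level set of [x^(n+1) (1 - x)], which increases up
   to [(n+1)/(n+2)] and decreases afterwards. *)
Lemma d2ell_zeros n b x y : 0 < x -> x < y -> y < 1 ->
  d2ell n b x = 0 -> d2ell n b y = 0 ->
  b_crit R n.+2 < b /\ x < n.+1%:R / n.+2%:R < y.
Proof.
move=> x0 xy y1.
move=> /d2ell_eq0; rewrite x0 (lt_trans xy) => // /(_ isT) hx.
move=> /d2ell_eq0; rewrite y1 (lt_trans x0) => // /(_ isT) hy.
set w := fun z => z ^+ n.+1 * (1 - z).
have dw z : 0 < z < 1 -> is_derive z 1 w (z ^+ n * (n.+1%:R - n.+2%:R * z)).
  by move=> _; exact: is_derive_expr1B.
have k0 : b * (n.+2%:R * n.+1%:R) != 0.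
  by apply/eqP => k0; move: hx; rewrite k0 mul0r => /esym/eqP; rewrite oner_eq0.
have wxy : w x = w y by apply: (mulfI k0); rewrite /w hx hy.
have [e /andP[xe ey]] := rolle_open01 _ _ _ _ dw x0 xy y1 wxy.
have e0 := lt_trans x0 xe.
move=> /eqP; rewrite mulf_eq0 expf_eq0 (gt_eqF e0) andbF /= subr_eq0 => /eqP ee.
have eE : e = n.+1%:R / n.+2%:R by rewrite ee mulrC mulKf.
split; last by rewrite -eE xe.
have [c /andP[xc ce] wce] := mvt_open01 _ _ _ _ dw x0 xe (lt_trans ey y1).
have c0 := lt_trans x0 xc.
have wxe : w x < w e.
  rewrite -subr_gt0 wce mulr_gt0 ?subr_gt0// mulr_gt0 ?exprn_gt0//.
  by rewrite subr_gt0 ee ltr_pM2l.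
have wx0 : 0 < w x by rewrite mulr_gt0 ?exprn_gt0// subr_gt0 (lt_trans xy).
have b0 : 0 < b * (n.+2%:R * n.+1%:R).
  by rewrite -(pmulr_lgt0 _ wx0) hx.
(* The level at [x] and [y] is 1, so the peak lies above 1; its height is exactly
   [b / b_crit R n.+2]. *)
have : 1 < b * (n.+2%:R * n.+1%:R) * w e.
  by rewrite -[X in X < _]hx -[_ * _ * (_ * _)]/(_ * w x) ltr_pM2l.
rewrite /b_crit/= ltr_pdivrMr ?exprn_gt0//.
have -> : b * (n.+2%:R * n.+1%:R) * w e = b * n.+1%:R ^+ n.+2 / n.+2%:R ^+ n.+1.
  have n2 : n.+2%:R != 0 :> R by rewrite pnatr_eq0.
  rewrite /w; have -> : 1 - e = n.+2%:R^-1.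
    by rewrite eE -[n.+2%:R]natr1 in n2 *; field.
  by rewrite eE expr_div_n [n.+1%:R ^+ n.+2]exprS; field; rewrite expf_neq0//= -natrD.
by rewrite ltr_pdivlMr ?exprn_gt0// mul1r.
Qed.

(* [ell] has infinite slope at both endpoints: compare with the value at
   distance [exp (-(k+1))] from the endpoint, [k] bounding the other slopes. *)
Lemma ell_maximizer_interior p a b x : (0 < p)%N -> ell_maximizers p a b x ->
  0 < x < 1.
Proof.
move=> p0 [+ xmax]; rewrite /unit_itv/= in_itv/= => /andP[].
have small (k : R) : 0 <= k -> exists2 t, 0 < t < 1 & - ln t = k + 1.
  move=> k0; exists (expR (- (k + 1))); last by rewrite expRK opprK.
  by rewrite expR_gt0 expR_lt1; lra.
have lnB t : 0 < t < 1 -> 0 <= - ((1 - t) * ln (1 - t)).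
  by move=> t01; rewrite oppr_ge0 mulr_ge0_le0 ?ln_le0//; lra.
have a0 : 0 <= `|a| by [].
have := ler_norm a; have := ler_norm (- a); rewrite normrN => aN aP.
have b0 : 0 <= `|b| by [].
have := ler_norm b; have := ler_norm (- b); rewrite normrN => bN bP.
rewrite le_eqVlt => /predU1P[x0|x0].
  (* With [k = |a| + |b|], the term [- t ln t = (k + 1) t] outweighs [a t + b t^p], as
     [t^p <= t]. *)
  have [t t01 lnt] := small _ (addr_ge0 a0 b0).
  have t0 : 0 < t by lra.
  exfalso; have := xmax t; rewrite /unit_itv/= in_itv/= -x0 /ell.
  rewrite subr0 ln1 !mulr0 mul0r expr0n (gtn_eqF p0) mulr0 => h.
  have {}h : a * t + b * t ^+ p - t * ln t - (1 - t) * ln (1 - t) <= 0.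
    by have := h ltac:(lra); lra.
  have := lnB _ t01.
  have tpt : t ^+ p <= t.
    by case: p p0 {xmax h} => // p _; rewrite exprS ler_piMr ?(ltW t0)//
      exprn_ile1//; lra.
  have tp0 : 0 <= t ^+ p by rewrite exprn_ge0 ?ltW.
  by nra.
rewrite le_eqVlt => /predU1P[x1|->]; last by rewrite x0.
(* Near 1 the slope of [b x^p] is controlled by [p |b|], through [1 - (1 - t)^p <= p t]. *)
have [t t01 lnt] := small _ (addr_ge0 a0 (mulr_ge0 (ler0n R p) b0)).
have t0 : 0 < t by lra.
exfalso; have := xmax (1 - t); rewrite /unit_itv/= in_itv/= x1 /ell.
rewrite expr1n subrr mul0r ln1 mulr0 (_ : 1 - (1 - t) = t) => [h|]; last by ring.
have {}h : a * (1 - t) + b * (1 - t) ^+ p - (1 - t) * ln (1 - t) - t * ln t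
    <= a + b.
  by have := h ltac:(lra); lra.
have := lnB _ t01.
(* Bernoulli's inequality: the tangent to [x^p] at 1, with [p = 1] treated directly. *)
have t1p : 1 - (1 - t) ^+ p <= p%:R * t.
  case: p p0 {xmax h lnt} => // -[|p] _; first by rewrite expr1; lra.
  have := @expr_tangent R p (1 - t) 1 ltac:(lra) ltac:(lra).
  by move=> [+ _]; rewrite !expr1n; lra.
have tp1 : 0 <= 1 - (1 - t) ^+ p by rewrite subr_ge0 exprn_ile1//; lra.
have : `|b| * (1 - (1 - t) ^+ p) <= `|b| * (p%:R * t) by rewrite ler_wpM2l.
by nra.
Qed.

Lemma dell_maximizer p a b x : (0 < p)%N -> ell_maximizers p a b x ->
  dell p a b x = 0.
Proof.
move=> p0 xm; have x01 := ell_maximizer_interior _ _ _ _ p0 xm.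
case: xm => _ xmax.
have h0 : is_derive x 1 (ell p a b) 0.
  apply: (@derive1_at_max _ _ 0 1) => //.
  - by move=> t; rewrite in_itv/= => /(is_derive_ell p a b)[].
  - by move=> t /subset_itv_oo_cc/xmax.
by case: h0 => _ <-; case: (is_derive_ell p a b _ x01) => _ ->.
Qed.

(** Two global maximizers share the same value, so Rolle's theorem applies between them. *)
Lemma ell_maximizers_crit n a b x y : ell_maximizers n.+2 a b x ->
  ell_maximizers n.+2 a b y -> x < y ->
  exists2 c, x < c < y & dell n.+2 a b c = 0.
Proof.
move=> xm ym xy.
have /andP[x0 _] := ell_maximizer_interior n.+2 _ _ _ isT xm.
have /andP[_ y1] := ell_maximizer_interior n.+2 _ _ _ isT ym.
apply: (rolle_open01 _ _ _ _ (is_derive_ell n.+2 a b)) => //.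
by apply/eqP; rewrite eq_le (proj2 xm) ?(proj2 ym)//; [case: xm|case: ym].
Qed.

(** [dell] vanishes at both maximizers and at a point between them, so [d2ell] has two zeros and
    [d2ell_zeros] applies. *)
Lemma two_ell_maximizers n a b x y : ell_maximizers n.+2 a b x ->
  ell_maximizers n.+2 a b y -> x < y -> b_crit R n.+2 < b.
Proof.
move=> xm ym xy.
have [c /andP[xc cy] dc] := ell_maximizers_crit _ _ _ _ _ xm ym xy.
have /andP[x0 _] := ell_maximizer_interior n.+2 _ _ _ isT xm.
have /andP[_ y1] := ell_maximizer_interior n.+2 _ _ _ isT ym.
have dx := dell_maximizer n.+2 _ _ _ isT xm.
have dy := dell_maximizer n.+2 _ _ _ isT ym.
have [u /andP[xu uc] du] := rolle_open01 _ _ _ _ (is_derive_dell n a b) x0 xc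
  (lt_trans cy y1) (etrans dx (esym dc)).
have [v /andP[cv vy] dv] := rolle_open01 _ _ _ _ (is_derive_dell n a b)
  (lt_trans x0 xc) cy y1 (etrans dc (esym dy)).
by have [] := d2ell_zeros n b u v (lt_trans x0 xu) (lt_trans uc cv)
  (lt_trans vy y1) du dv.
Qed.

(** Three maximizers would give zeros [u < v < w] of [d2ell]. Then [d2ell_zeros] puts [v] to the
    right of [(n+1)/(n+2)] by the pair [u, v] and to its left by the pair [v, w]. *)
Lemma three_ell_maximizers n a b x y z : ell_maximizers n.+2 a b x ->
  ell_maximizers n.+2 a b y -> ell_maximizers n.+2 a b z -> x < y -> ~ y < z.
Proof.
move=> xm ym zm xy yz.
have [c /andP[xc cy] dc] := ell_maximizers_crit _ _ _ _ _ xm ym xy.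
have [e /andP[ye ez] de] := ell_maximizers_crit _ _ _ _ _ ym zm yz.
have /andP[x0 _] := ell_maximizer_interior n.+2 _ _ _ isT xm.
have /andP[_ z1] := ell_maximizer_interior n.+2 _ _ _ isT zm.
have dx := dell_maximizer n.+2 _ _ _ isT xm.
have dy := dell_maximizer n.+2 _ _ _ isT ym.
have c0 := lt_trans x0 xc; have y0 := lt_trans x0 xy.
have e1 := lt_trans ez z1; have y1 := lt_trans ye e1.
have [u /andP[xu uc] du] := rolle_open01 _ _ _ _ (is_derive_dell n a b) x0 xc
  (lt_trans cy y1) (etrans dx (esym dc)).
have [v /andP[cv vy] dv] := rolle_open01 _ _ _ _ (is_derive_dell n a b)
  c0 cy y1 (etrans dc (esym dy)).
have [w /andP[yw we] dw] := rolle_open01 _ _ _ _ (is_derive_dell n a b)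
  y0 ye e1 (etrans dy (esym de)).
have v1 := lt_trans vy y1.
have [_ /andP[_ h1]] := d2ell_zeros n b u v (lt_trans x0 xu) (lt_trans uc cv)
  v1 du dv.
have [_ /andP[h2 _]] := d2ell_zeros n b v w (lt_trans c0 cv) (lt_trans vy yw)
  (lt_trans we e1) dv dw.
by have := lt_trans h1 h2; rewrite ltxx.
Qed.

(** The one-sided bound suffices because [x] and [y] may be exchanged; [|k| + 1] replaces [k] to
    have a positive divisor. *)
Lemma lipschitz_continuous (f : R -> R) (k : R) :
  (forall x y, f y - f x <= k * `|y - x|) -> continuous f.
Proof.
move=> fk x; apply/cvgrPdist_le => e e0.
have k0 : 0 < `|k| + 1 by rewrite ltr_wpDl.
near=> y.
have yx : `|x - y| <= e / (`|k| + 1).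
  by near: y; apply: cvgr_dist_le => //; rewrite divr_gt0.
apply: (@le_trans _ _ ((`|k| + 1) * `|x - y|)); last first.
  by rewrite mulrC -ler_pdivlMr.
have kk : k * `|x - y| <= (`|k| + 1) * `|x - y|.
  by rewrite ler_wpM2r// (le_trans (ler_norm k))// lerDl.
have := fk y x; have := fk x y; rewrite [`|y - x|]distrC => h1 h2.
by rewrite ler_norml; apply/andP; split; lra.
Unshelve. all: by end_near. Qed.

Lemma ell_shift p a b x : ell p a b x = ell p 0 b x + a * x.
Proof. by rewrite /ell; ring. Qed.

Lemma exists_balanced_slope p b e : (0 < p)%N -> 0 < e < 1 ->
  exists a x1 x2, [/\ x1 <= e, e <= x2, ell_maximizers p a b x1
    & ell_maximizers p a b x2].
Proof.
move=> p0 /andP[e0 e1].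
have evt x y a : x <= y -> exists c, c \in `[x, y] /\
    forall t, t \in `[x, y] -> ell p a b t <= ell p a b c.
  move=> xy; have [|c] := @EVT_max R (ell p a b) x y xy; last by exists c.
  by apply: continuous_subspaceT; exact: continuous_ell.
have [l lP] := choice (fun a => evt 0 e a (ltW e0)).
have [r rP] := choice (fun a => evt e 1 a (ltW e1)).
have [c [_ cmax]] := evt 0 1 0 ler01.
set C := ell p 0 b c in cmax.
have [lI lmax] := all_and2 lP; have [rI rmax] := all_and2 rP.
have l0 a : 0 <= l a by have := lI a; rewrite in_itv/= => /andP[].
have le a : l a <= e by have := lI a; rewrite in_itv/= => /andP[].
have er a : e <= r a by have := rI a; rewrite in_itv/= => /andP[].
have r1 a : r a <= 1 by have := rI a; rewrite in_itv/= => /andP[].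
pose F a := ell p a b (l a) - ell p a b (r a).
(* Testing each maximum against the maximizer found at the other slope gives
   [F y - F x <= (y - x) (l y - r x)], where [l y] and [r x] lie in [[0, 1]]. *)
have Fcont : continuous F.
  apply: (@lipschitz_continuous _ 2) => x y; rewrite /F.
  have := lmax x _ (lI y); have := rmax y _ (rI x).
  rewrite !(ell_shift _ x) !(ell_shift _ y).
  have := ler_norm (y - x); have := ler_norm (- (y - x)); rewrite normrN.
  have := l0 y; have := le y; have := er x; have := r1 x.
  by nra.
have ell0 a : ell p a b 0 = 0.
  by rewrite /ell subr0 ln1 !mulr0 mul0r expr0n (gtn_eqF p0) /= !(mulr0, mul0r, subr0, addr0).
have ell1 a : ell p a b 1 = a + b.
  by rewrite /ell subrr ln1 expr1n; ring.
have C0 : 0 <= C by rewrite -(ell0 0) cmax// in_itv/= lexx ler01.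
have Cb : b <= C by rewrite -[b]add0r -(ell1 0) cmax// in_itv/= lexx ler01.
(* At slope [N1] the value [N1 + b] at 1 equals the bound [C + N1 e] for the left half; at slope
   [- N2] the value 0 at 0 equals the bound [C - N2 e] for the right half. Hence [F] changes sign
   between them. *)
pose N1 := (C - b) / (1 - e); pose N2 := C / e.
have N1E : N1 * (1 - e) = C - b by rewrite /N1 divfK// gt_eqF ?subr_gt0.
have N2E : N2 * e = C by rewrite /N2 divfK// gt_eqF.
have N10 : 0 <= N1 by rewrite divr_ge0// subr_ge0// ltW.
have N20 : 0 <= N2 by rewrite divr_ge0// ltW.
have F1 : F N1 <= 0.
  have lC : ell p 0 b (l N1) <= C.
    by apply: cmax; rewrite in_itv/= l0 (le_trans (le _))// ltW.
  have := rmax N1 1; rewrite in_itv/= lexx (ltW e1) ell1 => /(_ isT).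
  rewrite /F (ell_shift _ _ _ (l N1)).
  by have := le N1; nra.
have F2 : 0 <= F (- N2).
  have rC : ell p 0 b (r (- N2)) <= C.
    by apply: cmax; rewrite in_itv/= r1 (le_trans _ (er _))// ltW.
  have := lmax (- N2) 0; rewrite in_itv/= lexx (ltW e0) ell0 => /(_ isT).
  rewrite /F (ell_shift _ _ _ (r (- N2))).
  by have := er (- N2); nra.
have [|||a _ Fa] := @IVT R F (- N2) N1 0.
- by lra.
- exact: continuous_subspaceT.
- by rewrite ge_min F1 orbT le_max F2.
exists a, (l a), (r a).
have lr : ell p a b (l a) = ell p a b (r a) by move/eqP: Fa; rewrite subr_eq0 => /eqP.
have gmax y : unit_itv R y -> ell p a b y <= ell p a b (l a).
  rewrite /unit_itv/= in_itv/= => /andP[y0 y1].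
  have [ye|ey] := leP y e; first by rewrite lmax// in_itv/= y0.
  by rewrite lr rmax// in_itv/= y1 (ltW ey).
split => //; split.
- by rewrite /unit_itv/= in_itv/= l0 (le_trans (le _))// ltW.
- exact: gmax.
- by rewrite /unit_itv/= in_itv/= r1 (le_trans _ (er _))// ltW.
- by rewrite -lr; exact: gmax.
Qed.

Lemma notin_U_maximizer n b e : 0 < e < 1 -> ~ U_region R n.+2 (e, b) ->
  exists a, ell_maximizers n.+2 a b e.
Proof.
move=> e01 nU.
have [a [x1 [x2 [x1e ex2 m1 m2]]]] := exists_balanced_slope n.+2 b _ isT e01.
exists a; move: x1e ex2; rewrite le_eqVlt => /predU1P[<-//|x1e].
rewrite le_eqVlt => /predU1P[->//|ex2]; exfalso; apply: nU; split => /=.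
  exact: two_ell_maximizers m1 m2 (lt_trans x1e ex2).
have x12 := lt_trans x1e ex2.
exists a, x1, x2; split => //.
- by have /andP[] := ell_maximizer_interior n.+2 _ _ _ isT m1.
- by have /andP[] := ell_maximizer_interior n.+2 _ _ _ isT m2.
(* A further maximizer would lie left of [x1], between the two, or right of [x2]; each position
   gives three ordered maximizers. *)
- apply/seteqP; split => z; last by case=> ->.
  move=> mz /=; have [zx1|x1z|->] := ltgtP z x1; last by left.
    by have := three_ell_maximizers _ _ _ _ _ _ mz m1 m2 zx1 x12.
  have [zx2|x2z|->] := ltgtP z x2; last by right.
    by have := three_ell_maximizers _ _ _ _ _ _ m1 mz m2 x1z zx2.
  by have := three_ell_maximizers _ _ _ _ _ _ m1 m2 mz x12 x2z.
- by rewrite x1e.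
Qed.
End EllMaximizers.

(** * Integration of bounded measurable functions over a set of measure 1 *)

Section BoundedMeasurable.
Context {d : measure_display} {T : measurableType d} {R : realType}.
Variables (mu : {measure set T -> \bar R}) (D : set T).
Implicit Types f g : T -> R.

(** This class is closed under the algebraic operations used below and consists of integrable
    functions once [D] has measure 1, so it settles all integrability conditions. *)
Definition bmfun f :=
  measurable_fun D f /\ exists M, forall z, D z -> `|f z| <= M.

Lemma bmfun_cst c : bmfun (cst c).
Proof. by split; [exact: measurable_cst|exists `|c|]. Qed.

Lemma bmfunD f g : bmfun f -> bmfun g -> bmfun (fun z => f z + g z).
Proof.
move=> [mf [M fM]] [mg [N gN]]; split; first exact: measurable_funD.
by exists (M + N) => z Dz; rewrite (le_trans (ler_normD _ _))// lerD ?fM ?gN.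
Qed.

Lemma bmfunM f g : bmfun f -> bmfun g -> bmfun (fun z => f z * g z).
Proof.
move=> [mf [M fM]] [mg [N gN]]; split; first exact: measurable_funM.
by exists (M * N) => z Dz; rewrite normrM ler_pM ?fM ?gN.
Qed.

Lemma bmfunX f n : bmfun f -> bmfun (fun z => f z ^+ n).
Proof.
move=> bf; elim: n => [|n ih]; first exact: bmfun_cst.
by under eq_fun do rewrite exprS; exact: bmfunM.
Qed.

Lemma bmfunZ c f : bmfun f -> bmfun (fun z => c * f z).
Proof. by move=> bf; apply: bmfunM => //; exact: bmfun_cst. Qed.

(** A constant plus four terms is the common shape of the integrands built later; shorter ones are
    padded with zero coefficients. *)
Lemma bmfun_lin4 c0 c1 c2 c3 c4 f1 f2 f3 f4 :
  bmfun f1 -> bmfun f2 -> bmfun f3 -> bmfun f4 ->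
  bmfun (fun z => c0 + c1 * f1 z + c2 * f2 z + c3 * f3 z + c4 * f4 z).
Proof.
move=> b1 b2 b3 b4; have b0 := bmfun_cst c0.
by do ![exact: bmfunZ | exact: b0 | apply: bmfunD].
Qed.

Hypotheses (mD : measurable D) (muD : mu D = 1%E).

Lemma bmfun_integrable f : bmfun f -> mu.-integrable D (EFin \o f).
Proof.
move=> [mf [M fM]]; apply: measurable_bounded_integrable => //.
  by rewrite muD ltry.
exists M; split; first exact: num_real.
by move=> N MN z Dz; exact: le_trans (fM z Dz) (ltW MN).
Qed.

Lemma Rintegral_lin4 c0 c1 c2 c3 c4 f1 f2 f3 f4 :
  bmfun f1 -> bmfun f2 -> bmfun f3 -> bmfun f4 ->
  \int[mu]_(z in D) (c0 + c1 * f1 z + c2 * f2 z + c3 * f3 z + c4 * f4 z) =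
  c0 + c1 * \int[mu]_(z in D) f1 z + c2 * \int[mu]_(z in D) f2 z
  + c3 * \int[mu]_(z in D) f3 z + c4 * \int[mu]_(z in D) f4 z.
Proof.
move=> b1 b2 b3 b4.
have b0 := bmfun_cst c0.
have i1 := bmfunZ c1 _ b1; have i2 := bmfunZ c2 _ b2.
have i3 := bmfunZ c3 _ b3; have i4 := bmfunZ c4 _ b4.
have j1 := bmfunD _ _ b0 i1; have j2 := bmfunD _ _ j1 i2.
have j3 := bmfunD _ _ j2 i3.
rewrite RintegralD//; try exact: bmfun_integrable.
rewrite RintegralD//; try exact: bmfun_integrable.
rewrite RintegralD//; try exact: bmfun_integrable.
rewrite RintegralD//; try exact: bmfun_integrable.
rewrite !RintegralZl//; try exact: bmfun_integrable.
by rewrite Rintegral_cst// muD mulr1.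
Qed.

Lemma Rintegral_prob_cst c : \int[mu]_(_ in D) c = c.
Proof. by rewrite Rintegral_cst// muD mulr1. Qed.

Lemma ae_imply_in (P Q : T -> Prop) : (forall z, D z -> P z -> Q z) ->
  {ae mu, forall z, D z -> P z} -> {ae mu, forall z, D z -> Q z}.
Proof. by move=> PQ; apply: filterS => z Pz Dz; apply: PQ => //; exact: Pz. Qed.

(** Turns equality in an integrated bound into pointwise equality a.e.: the integral of [|f|] is
    squeezed to zero. *)
Lemma Rintegral_le0_ae f : bmfun f -> (forall z, D z -> 0 <= f z) ->
  \int[mu]_(z in D) f z <= 0 -> {ae mu, forall z, D z -> f z = 0}.
Proof.
move=> bf f0 If.
have intf := bmfun_integrable _ bf; have [mf _] := bf.
have : ae_eq mu D (EFin \o f) (cst 0%E).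
  apply/(ae_eq_integral_abs mu mD); first exact/measurable_EFinP.
  have -> : (\int[mu]_(x in D) `|(EFin \o f) x|)%E = (\int[mu]_(x in D) (f x)%:E)%E.
    by apply: eq_integral => x /set_mem Dx /=; rewrite ger0_norm ?f0.
  have Ifin := integrable_fin_num mD intf.
  rewrite -(fineK Ifin); congr EFin.
  by apply/eqP; rewrite eq_le [X in X && _]If Rintegral_ge0.
by apply: filterS => z h Dz; have := h Dz => -[].
Qed.

Lemma eq_ae_Rintegral f g : bmfun f -> bmfun g ->
  {ae mu, forall z, D z -> f z = g z} ->
  \int[mu]_(z in D) f z = \int[mu]_(z in D) g z.
Proof.
move=> [mf _] [mg _] fg; congr fine; apply: ae_eq_integral => //.
- exact/measurable_EFinP.
- exact/measurable_EFinP.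
- by apply: filterS fg => z h Dz; rewrite h.
Qed.

End BoundedMeasurable.

(** * Fubini and coordinate exchange on the unit square *)

Section Square.
Context {R : realType}.
Local Notation mu := (leb R).
Local Notation mu2 := (leb2 R).
Local Notation I := (unit_itv R).
Local Notation S := (unit_square R).
Local Notation bmI := (@bmfun _ (measurableTypeR R) R I).
Local Notation bmS := (@bmfun _ (measurableTypeR R * measurableTypeR R)%type R S).

Lemma measurable_unit_itv : @measurable _ (measurableTypeR R) I.
Proof. exact: measurable_itv. Qed.
Hint Resolve measurable_unit_itv : core.

Lemma measurable_unit_square :
  @measurable _ (measurableTypeR R * measurableTypeR R)%type S.
Proof. exact: measurableX. Qed.
Hint Resolve measurable_unit_square : core.

Lemma unit_itv_measure1 : mu I = 1%E.
Proof. by rewrite lebesgue_measure_itv/= lte_fin ltr01 oppr0 adde0. Qed.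

Lemma unit_square_measure1 : mu2 S = 1%E.
Proof.
transitivity (mu I * mu I)%E; first exact: product_measure1E.
by rewrite unit_itv_measure1 mule1. Qed.

Lemma integrable_I (f : R -> R) : bmI f -> mu.-integrable I (EFin \o f).
Proof. exact: (bmfun_integrable mu _ measurable_unit_itv unit_itv_measure1). Qed.

Lemma integrable_S (f : R * R -> R) : bmS f -> mu2.-integrable S (EFin \o f).
Proof.
exact: (bmfun_integrable mu2 _ measurable_unit_square unit_square_measure1).
Qed.

Lemma Rintegral_I_cst c : \int[mu]_(_ in I) c = c.
Proof. exact: (Rintegral_prob_cst mu _ measurable_unit_itv unit_itv_measure1). Qed.

Lemma Rintegral_S_cst c : \int[mu2]_(_ in S) c = c.
Proof.
exact: (Rintegral_prob_cst mu2 _ measurable_unit_square unit_square_measure1).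
Qed.

Lemma Rintegral_S_lin4 c0 c1 c2 c3 c4 (f1 f2 f3 f4 : R * R -> R) :
  bmS f1 -> bmS f2 -> bmS f3 -> bmS f4 ->
  \int[mu2]_(z in S) (c0 + c1 * f1 z + c2 * f2 z + c3 * f3 z + c4 * f4 z) =
  c0 + c1 * \int[mu2]_(z in S) f1 z + c2 * \int[mu2]_(z in S) f2 z
  + c3 * \int[mu2]_(z in S) f3 z + c4 * \int[mu2]_(z in S) f4 z.
Proof.
exact: (Rintegral_lin4 mu2 _ measurable_unit_square unit_square_measure1).
Qed.

Lemma Rintegral_S_le0_ae (f : R * R -> R) : bmS f ->
  (forall z, S z -> 0 <= f z) -> \int[mu2]_(z in S) f z <= 0 ->
  {ae mu2, forall z, S z -> f z = 0}.
Proof.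
exact: (Rintegral_le0_ae mu2 _ measurable_unit_square unit_square_measure1).
Qed.

Lemma bmfun_fst (g : R -> R) : bmI g -> bmS (fun z => g z.1).
Proof.
move=> [mg [M gM]]; split; last by exists M => -[x y] [/gM].
apply: (@measurable_comp _ _ _ _ _ _ I g S fst) => //.
- by move=> _ [[x y] [? _] <-].
- exact: measurable_funTS.
Qed.

Lemma bmfun_swap (f : R * R -> R) : bmS f -> bmS (fun z => f (z.2, z.1)).
Proof.
move=> [mf [M fM]]; split; last by exists M => -[x y] [? ?]; apply: fM.
apply: (@measurable_comp _ _ _ _ _ _ S f S (fun z => (z.2, z.1))) => //.
- by move=> _ [[x y] [? ?] <-].
- by apply: measurable_funTS; exact: measurable_swap.
Qed.

Lemma bmfun_section (f : R * R -> R) x : bmS f -> I x ->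
  bmI (fun y => f (x, y)).
Proof.
move=> [mf [M fM]] Ix; split; last by exists M => y Iy; apply: fM.
apply: (@measurable_comp _ _ _ _ _ _ S f I (pair x)) => //.
- by move=> _ [y Iy <-].
- by apply: measurable_funTS; exact: pair1_measurable.
Qed.

(** Links Fubini on the whole plane, applied to [f] extended by zero off the square, with integrals
    restricted to [I]. *)
Lemma fubini_F_unit_square (f : R * R -> R) : bmS f ->
  @fubini_F _ _ (measurableTypeR R) (measurableTypeR R) R mu ((EFin \o f) \_ S) =
  (EFin \o (fun x => \int[mu]_(y in I) f (x, y))) \_ I.
Proof.
move=> bf; apply/funext => x; rewrite /fubini_F patchE.
case: ifPn => [/set_mem Ix|/negP xI].
  have ifin := integrable_fin_num measurable_unit_itv
    (integrable_I _ (bmfun_section _ _ bf Ix)).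
  rewrite /comp /Rintegral fineK//.
  rewrite [RHS]integral_mkcond; apply: eq_integral => y _.
  rewrite !patchE; congr (if _ then _ else _).
  by apply/idP/idP => /set_mem h; apply/mem_set => //; case: h.
apply: integral0_eq => y _; rewrite patchE; case: ifPn => // /set_mem [h _].
by case: xI; exact/mem_set.
Qed.

Lemma Fubini_unit_square (f : R * R -> R) : bmS f ->
  \int[mu2]_(z in S) f z = \int[mu]_(x in I) \int[mu]_(y in I) f (x, y).
Proof.
move=> bf; rewrite /Rintegral; congr fine.
have intf := integrable_S _ bf.
have /integral12_prod_meas1 := (integrable_mkcond _ measurable_unit_square).1 intf.
by rewrite fubini_F_unit_square// -!integral_mkcond => <-.
Qed.

(** Measurability of the partial integral comes from Fubini, and averaging over [I] preserves the
    bound [M]. *)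
Lemma bmfun_degree (f : R * R -> R) : bmS f ->
  bmI (fun x => \int[mu]_(y in I) f (x, y)).
Proof.
move=> bf; split.
  have intf := integrable_S _ bf.
  have /measurable_fubini_F := (integrable_mkcond _ measurable_unit_square).1 intf.
  rewrite fubini_F_unit_square// => mF; apply/measurable_EFinP.
  by apply/(measurable_restrictT _ measurable_unit_itv).
have [_ [M fM]] := bf; exists M => x Ix.
have bx := bmfun_section _ _ bf Ix.
have ix := integrable_I _ bx.
apply: le_trans (le_normr_Rintegral measurable_unit_itv ix) _.
rewrite -[M]Rintegral_I_cst.
apply: le_Rintegral => //.
- exact: integrable_norm.
- exact: (integrable_I _ (bmfun_cst _ _)).
- by move=> y Iy; exact: fM.
Qed.

(** Both sides are the same iterated integral, expanded in opposite orders. *)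
Lemma Rintegral_swap (f : R * R -> R) : bmS f ->
  \int[mu2]_(z in S) f (z.2, z.1) = \int[mu2]_(z in S) f z.
Proof.
move=> bf; have bg := bmfun_swap _ bf.
rewrite /Rintegral; congr fine; rewrite [LHS]integral_mkcond [RHS]integral_mkcond.
have i1 := integrable_S _ bf.
have i2 := integrable_S _ bg.
have i1' := (integrable_mkcond _ measurable_unit_square).1 i1.
have i2' := (integrable_mkcond _ measurable_unit_square).1 i2.
rewrite -[LHS](integral12_prod_meas1 i2') -[RHS](integral21_prod_meas1 i1').
apply: eq_integral => x _; apply: eq_integral => y _.
rewrite !patchE; congr (if _ then _ else _).
by apply/idP/idP => /set_mem [? ?]; apply/mem_set.
Qed.

End Square.

(** * Bounds on the objective and their equality cases *)

Section Graphons.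
Context {R : realType}.
Local Notation mu := (leb R).
Local Notation mu2 := (leb2 R).
Local Notation I := (unit_itv R).
Local Notation S := (unit_square R).
Local Notation bmI := (@bmfun _ (measurableTypeR R) R I).
Local Notation bmS := (@bmfun _ (measurableTypeR R * measurableTypeR R)%type R S).
Local Notation degree h := (fun x => \int[mu]_(y in I) h (x, y)).
Implicit Types (b c s eps : R) (h : R * R -> R).

Lemma Rintegral_fst (g : R -> R) : bmI g ->
  \int[mu2]_(z in S) g z.1 = \int[mu]_(x in I) g x.
Proof.
move=> bg; rewrite (Fubini_unit_square _ (bmfun_fst _ bg)).
by under eq_Rintegral do rewrite /= Rintegral_I_cst.
Qed.

Lemma Rintegral_fst_mul (g : R -> R) h : bmI g -> bmS h ->
  \int[mu2]_(z in S) (g z.1 * h z) = \int[mu]_(x in I) (g x * degree h x).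
Proof.
move=> bg bh; rewrite Fubini_unit_square; last by apply: bmfunM => //; exact: (bmfun_fst _ bg).
apply: eq_Rintegral => x /set_mem Ix; rewrite /= RintegralZl//.
  exact: measurable_unit_itv.
exact/integrable_I/bmfun_section.
Qed.

Lemma bmfun_graphon h : graphon h -> bmS h.
Proof.
move=> [mh h01 _]; split => //; exists 1 => z /h01 /andP[h0 h1].
by rewrite ger0_norm.
Qed.

Lemma degree01 h x : graphon h -> I x -> 0 <= degree h x <= 1.
Proof.
move=> gh Ix; have [_ h01 _] := gh; apply/andP; split.
  by apply: Rintegral_ge0 => y Iy; have /andP[] := h01 (x, y) (conj Ix Iy).
rewrite -[leRHS](Rintegral_I_cst 1); apply: le_Rintegral.
- exact: measurable_unit_itv.
- exact/integrable_I/bmfun_section/Ix/bmfun_graphon.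
- exact/integrable_I/bmfun_cst.
- by move=> y Iy; have /andP[] := h01 (x, y) (conj Ix Iy).
Qed.

Lemma bmfun_entropyI h : graphon h -> bmS (fun z => entropyI (h z)).
Proof.
move=> gh; have [mh _] := bmfun_graphon _ gh; have [_ h01 _] := gh.
split.
  have m1h : @measurable_fun _ _ (measurableTypeR R * measurableTypeR R)%type R
    S (fun z => 1 - h z) by apply: measurable_funB => //; exact: measurable_cst.
  apply: measurable_funD; apply: measurable_funM => //;
    by apply: measurableT_comp => //; exact: measurable_ln.
exists 8 => z /h01 hz.
have bound (x : R) : 0 <= x <= 1 -> `|x * ln x| <= 4.
  move=> /andP[x0 x1]; apply: le_trans (xlnx_bound x) _.
  have : Num.sqrt x <= 1 by rewrite -sqrtr1 ler_wsqrtr.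
  by rewrite ger0_norm//; have := sqrtr_ge0 x; nra.
rewrite /entropyI (le_trans (ler_normD _ _))//.
have := bound (h z) hz; have := bound (1 - h z) ltac:(lra).
by lra.
Qed.

(** Twice the objective of the constant graphon [x] when [b = 2 beta2]; also [ell] without its
    linear term. *)
Definition gain p b x := b * x ^+ p - entropyI x.

Lemma objectiveE p (beta2 : R) h : 2 * objective p beta2 h =
  2 * beta2 * star_density p h - \int[mu2]_(z in S) entropyI (h z).
Proof. by rewrite /objective; field. Qed.

Lemma Rintegral_degree eps h : feasible eps h -> \int[mu]_(x in I) degree h x = eps.
Proof. by move=> [gh <-]; rewrite -Fubini_unit_square//; exact: bmfun_graphon. Qed.

(* A pointwise nonnegative integrand whose integral is the gap between twice the
   objective of the constant graphon and twice that of [h]. *)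
Definition deficit_certificate p (beta2 : R) eps h (rel : R * R -> Prop) :=
  exists2 D : R * R -> R, bmS D /\ (forall z, S z -> 0 <= D z /\ (D z = 0 -> rel z)) &
  \int[mu2]_(z in S) D z = gain p (2 * beta2) eps - 2 * objective p beta2 h.

(** The integrand is [- b] times the power remainder of the degree at [eps], plus the entropy
    remainder of [h] at [eps]. The linear parts integrate to zero because the degree and [h] both
    have mean [eps]. Only the entropy remainder yields [h z = eps], since [b] may be zero. *)
Lemma certificate_nonpos n (beta2 : R) eps h : beta2 <= 0 -> 0 < eps < 1 ->
  feasible eps h -> deficit_certificate n.+2 beta2 eps h (fun z => h z = eps).
Proof.
move=> b0 e01 fh; have [gh hE] := fh; have [_ h01 _] := gh.
have bh := bmfun_graphon _ gh; have bd := bmfun_degree _ bh.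
set b := 2 * beta2; have {}b0 : b <= 0 by rewrite /b; lra.
have bd1 := bmfun_fst _ bd; have bdp := bmfun_fst _ (bmfunX _ _ n.+2 bd).
have bE := bmfun_entropyI _ gh.
set L := ln eps - ln (1 - eps).
(* The two remainders are expanded into the form of [bmfun_lin4] for integration, and regrouped
   below for the sign. *)
exists (fun z => ((b * (eps ^+ n.+2 - n.+2%:R * eps ^+ n.+2)
      - entropyI eps + L * eps)
   + (- b) * (degree h z.1) ^+ n.+2
   + (b * (n.+2%:R * eps ^+ n.+1)) * degree h z.1
   + 1 * entropyI (h z) + (- L) * h z)).
  split.
    exact: (bmfun_lin4 _ _ _ _ _ _ _ _ _ _ bdp bd1 bE bh).
  move=> [x y] Sxy; have [Ix Iy] := Sxy => /=.
  have /andP[d0 _] := degree01 _ _ gh Ix.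
  have [t1 _] := expr_tangent n _ eps d0 ltac:(lra).
  have {}t1 : 0 <= (- b) * (degree h x ^+ n.+2 - eps ^+ n.+2
     - n.+2%:R * eps ^+ n.+1 * (degree h x - eps)).
    by rewrite mulr_ge0// oppr_ge0.
  have [t2 t2E] := entropyI_tangent _ _ (h01 _ Sxy) e01.
  rewrite (_ : _ + _ = (- b) * (degree h x ^+ n.+2 - eps ^+ n.+2
     - n.+2%:R * eps ^+ n.+1 * (degree h x - eps))
     + (entropyI (h (x, y)) - entropyI eps - L * (h (x, y) - eps))); last first.
    by rewrite !(exprS eps); ring.
  split=> [|/eqP]; first exact: addr_ge0.
  by rewrite paddr_eq0// => /andP[_]; rewrite eq_sym t2E => /eqP.
rewrite (Rintegral_S_lin4 _ _ _ _ _ _ _ _ _ bdp bd1 bE bh).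
rewrite (Rintegral_fst _ bd) (Rintegral_fst _ (bmfunX _ _ n.+2 bd)) (Rintegral_degree _ _ fh).
rewrite (hE : \int[mu2]_(z in S) h z = _) objectiveE /star_density /gain -/b.
by rewrite !(exprS eps); ring.
Qed.

(** The integrand is [ell eps - ell (h z)], nonnegative by maximality, plus [b] times the power
    remainder of [h z] at the degree, which vanishes only if [h z] equals the degree. *)
Lemma certificate_pos n (beta2 : R) eps a h : 0 < beta2 -> unit_itv R eps ->
  ell_maximizers n.+2 a (2 * beta2) eps ->
  feasible eps h ->
  deficit_certificate n.+2 beta2 eps h (fun z => h z = degree h z.1).
Proof.
move=> b0 _ [_ emax] fh; have [gh hE] := fh; have [_ h01 _] := gh.
have bh := bmfun_graphon _ gh; have bd := bmfun_degree _ bh.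
set b := 2 * beta2 in emax *; have {}b0 : 0 < b by rewrite /b; lra.
have bdp := bmfunX _ _ n.+2 bd; have bdp1 := bmfunX _ _ n.+1 bd.
have bE := bmfun_entropyI _ gh.
have bdh := bmfunM _ _ _ (bmfun_fst _ bdp1) bh.
have bdp' := bmfun_fst _ bdp.
exists (fun z => (gain n.+2 b eps + a * eps)
   + (- a) * h z
   + (b * (n.+2%:R - 1)) * (degree h z.1) ^+ n.+2
   + (- b * n.+2%:R) * (degree h z.1 ^+ n.+1 * h z)
   + 1 * entropyI (h z)).
  split.
    exact: (bmfun_lin4 _ _ _ _ _ _ _ _ _ _ bh bdp' bdh bE).
  move=> [x y] Sxy; have [Ix Iy] := Sxy => /=.
  have /andP[d0 _] := degree01 _ _ gh Ix.
  have hxy := h01 _ Sxy; have /andP[h0 _] := hxy.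
  have [t1 t1E] := expr_tangent n _ _ h0 d0.
  have t2 : 0 <= ell n.+2 a b eps - ell n.+2 a b (h (x, y)).
    by rewrite subr_ge0 emax// /unit_itv/= in_itv.
  rewrite (_ : _ + _ = (ell n.+2 a b eps - ell n.+2 a b (h (x, y)))
     + b * (h (x, y) ^+ n.+2 - degree h x ^+ n.+2
     - n.+2%:R * degree h x ^+ n.+1 * (h (x, y) - degree h x))); last first.
    by rewrite /gain /ell /entropyI (exprS (degree h x)); ring.
  have {}t1 := mulr_ge0 (ltW b0) t1.
  split=> [|/eqP]; first exact: addr_ge0.
  rewrite paddr_eq0// => /andP[_].
  by rewrite mulf_eq0 (gt_eqF b0)/= eq_sym t1E => /eqP.
rewrite (Rintegral_S_lin4 _ _ _ _ _ _ _ _ _ bh bdp' bdh bE).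
rewrite (Rintegral_fst _ bdp) (Rintegral_fst_mul _ _ bdp1 bh).
rewrite (hE : \int[mu2]_(z in S) h z = _) objectiveE /star_density /gain -/b.
(* Integrating over [y] turns [d^(p-1) h] into [d^p], so the coefficients [b (p - 1)] and [- b p]
   combine to [- b]. *)
rewrite (_ : \int[mu]_(x in I) (degree h x ^+ n.+1 * degree h x) =
  \int[mu]_(x in I) degree h x ^+ n.+2); last by apply: eq_Rintegral => x _; rewrite -exprSr.
by ring.
Qed.

Lemma feasible_cst eps : 0 <= eps <= 1 -> feasible eps (cst eps).
Proof.
move=> e01; split; first by split => //; exact: measurable_cst.
by rewrite /edge_density Rintegral_S_cst.
Qed.

Lemma objective_cst p (beta2 : R) eps :
  2 * objective p beta2 (cst eps) = gain p (2 * beta2) eps.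
Proof.
rewrite objectiveE /star_density /gain /=.
rewrite Rintegral_S_cst.
by rewrite !Rintegral_I_cst.
Qed.

(** Certificates for all feasible graphons bound the objective from above, so [sup] is a genuine
    supremum and dominates the constant graphon. The deficit of an optimizer is then at most zero,
    which makes its certificate vanish a.e. *)
Lemma optimal_rel p (beta2 : R) eps h (rel : (R * R -> R) -> R * R -> Prop) :
  0 <= eps <= 1 ->
  (forall g, feasible eps g -> deficit_certificate p beta2 eps g (rel g)) ->
  optimizing_graphon p eps beta2 h ->
  {ae mu2, forall z, S z -> rel h z}.
Proof.
move=> e01 cert [fh hopt].
have ub : ubound (objective p beta2 @` feasible eps) (gain p (2 * beta2) eps / 2).
  move=> _ [g fg <-]; have [D [_ Dpos] DE] := cert g fg.
  have : 0 <= \int[mu2]_(z in S) D z by apply: Rintegral_ge0 => z /Dpos[].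
  by rewrite DE; lra.
have : gain p (2 * beta2) eps <= 2 * objective p beta2 h.
  rewrite hopt -objective_cst ler_pM2l//; apply: ub_le_sup.
    by eexists; exact: ub.
  by exists (cst eps) => //; exact: feasible_cst.
have [D [bD Dpos] DE] := cert h fh => le_obj.
have := Rintegral_S_le0_ae D bD.
rewrite DE subr_le0 => /(_ (fun z Sz => (Dpos z Sz).1) le_obj).
by apply: ae_imply_in => z Sz; exact: (Dpos z Sz).2.
Qed.

(* By symmetry [E (h (x,y) d x) = E (h (x,y) d y) = E (d x d y) = eps^2], so the
   variance of [h] vanishes. *)
Lemma eq_degree_uniform eps h : feasible eps h ->
  {ae mu2, forall z, S z -> h z = degree h z.1} ->
  {ae mu2, forall z, S z -> h z = eps}.
Proof.
move=> fh hd; have [gh hE] := fh; have [_ _ hsym] := gh.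
have bh := bmfun_graphon _ gh; have bd := bmfun_degree _ bh.
have bd1 := bmfun_fst _ bd; have bd2 := bmfun_swap _ bd1; rewrite /= in bd2.
have hdE : \int[mu2]_(z in S) (degree h z.1 * h z) = eps ^+ 2.
  transitivity (\int[mu2]_(z in S) (degree h z.2 * h z)).
    rewrite -[LHS]Rintegral_swap; last exact: bmfunM.
    by apply: eq_Rintegral => -[x y] /set_mem[Ix Iy] /=; rewrite hsym.
  transitivity (\int[mu2]_(z in S) (degree h z.2 * degree h z.1)).
    apply: (eq_ae_Rintegral mu2 _ measurable_unit_square).
    - exact: bmfunM.
    - exact: bmfunM.
    - by apply: (ae_imply_in mu2 S _ _ _ hd) => z Sz ->.
  under eq_Rintegral do rewrite mulrC.
  rewrite (Rintegral_fst_mul _ _ bd bd2).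
  under eq_Rintegral do rewrite (Rintegral_degree _ _ fh).
  by rewrite (RintegralZr _ measurable_unit_itv (integrable_I _ bd))
    (Rintegral_degree _ _ fh) expr2.
have h2E : \int[mu2]_(z in S) (h z * h z) = eps ^+ 2.
  rewrite -hdE; apply: (eq_ae_Rintegral mu2 _ measurable_unit_square).
  - exact: bmfunM.
  - exact: bmfunM.
  - by apply: (ae_imply_in mu2 S _ _ _ hd) => z Sz {1}->.
pose D z := eps ^+ 2 + (- (2 * eps)) * h z + 1 * (h z * h z) + 0 * h z + 0 * h z.
have DE z : D z = (h z - eps) ^+ 2 by rewrite /D; ring.
have bhh := bmfunM _ _ _ bh bh.
have bD : bmS D.
  exact: (bmfun_lin4 _ _ _ _ _ _ _ _ _ _ bh bhh bh bh).
have := Rintegral_S_le0_ae D bD.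
rewrite (Rintegral_S_lin4 _ _ _ _ _ _ _ _ _ bh bhh bh bh).
rewrite h2E (hE : \int[mu2]_(z in S) h z = _) => H.
have {}H := H (fun z _ => ltac:(rewrite DE; exact: sqr_ge0)) ltac:(lra).
apply: (ae_imply_in mu2 S _ _ _ H) => z Sz /eqP.
by rewrite DE sqrf_eq0 subr_eq0 => /eqP.
Qed.

(** At the endpoints 0 and 1 the entropy has no tangent line, but the edge density alone determines
    [h] a.e. *)
Lemma feasible0 h : feasible 0 h -> {ae mu2, forall z, S z -> h z = 0}.
Proof.
move=> [gh hE]; have [_ h01 _] := gh; have bh := bmfun_graphon _ gh.
apply: (Rintegral_S_le0_ae h bh).
  by move=> z /h01 /andP[].
by rewrite (hE : \int[mu2]_(z in S) h z = _).
Qed.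

Lemma feasible1 h : feasible 1 h -> {ae mu2, forall z, S z -> h z = 1}.
Proof.
move=> [gh hE]; have [_ h01 _] := gh; have bh := bmfun_graphon _ gh.
pose D z := 1 + (- 1) * h z + 0 * h z + 0 * h z + 0 * h z.
have DE z : D z = 1 - h z by rewrite /D; ring.
have bD : bmS D.
  exact: (bmfun_lin4 _ _ _ _ _ _ _ _ _ _ bh bh bh bh).
have := Rintegral_S_le0_ae D bD.
rewrite (Rintegral_S_lin4 _ _ _ _ _ _ _ _ _ bh bh bh bh).
rewrite (hE : \int[mu2]_(z in S) h z = _) => H.
have {}H : {ae mu2, forall z, S z -> D z = 0}.
  by apply: H => [z /h01|]; rewrite ?DE; lra.
by apply: (ae_imply_in mu2 S _ _ _ H) => z Sz; rewrite DE; lra.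
Qed.

End Graphons.

(** * Assembly: endpoint densities, then [beta2 <= 0], then [beta2 > 0] *)

Theorem proposition13 (R : realType) (p : nat) (p_ge2 : (2 <= p)%N)
    (eps beta2 : R) (eps01 : 0 <= eps <= 1)
    (notU : ~ U_region R p (eps, 2 * beta2)) (h : R * R -> R)
    (h_opt : optimizing_graphon p eps beta2 h) :
  uniform_graphon h.
Proof.
case: p p_ge2 notU h_opt => // -[//|n] _ notU h_opt.
exists eps; have [fh _] := h_opt.
move: (eps01) => /andP[]; rewrite le_eqVlt => /predU1P[e0|e0].
  by rewrite -e0 in fh * => _; exact: feasible0.
rewrite le_eqVlt => /predU1P[e1|e1]; first by rewrite e1 in fh *; exact: feasible1.
have e01 : 0 < eps < 1 by rewrite e0.
have [b0|b0] := leP beta2 0.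
  apply: (optimal_rel _ _ _ _ (fun g z => g z = eps) eps01 _ h_opt) => g.
  exact: certificate_nonpos.
have [a amax] := notin_U_maximizer _ _ _ e01 notU.
apply: eq_degree_uniform fh _.
apply: (optimal_rel _ _ _ _
  (fun g z => g z = \int[leb R]_(y in unit_itv R) g (z.1, y)) eps01 _ h_opt) => g.
by apply: certificate_pos amax => //; case: amax.
Qed.
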